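(* Let $v\ge4$. As formal power series in $y$, \[1+\sum_{d=1}^\infty \sum_{D \in \mathcal{D}_{v,d}(132,213,321)} x^{des(\pi_D)}y^d = \frac{1-y+xy^2}{(1-y)^2}.\]
   Context: A diamond with $v$ vertices ($v\ge4$) is the poset with a least element, a greatest element, and $v-2$ pairwise incomparable middle elements (in a fixed left-to-right order) strictly between them. $\mathcal{D}_{v,d}$ is the set of labellings of $d$ diamonds (placed left to right) by $1,\dots,vd$, each label used once, such that in each diamond least label $<$ each middle label $<$ greatest label. For $D\in\mathcal{D}_{v,d}$, $\pi_D$ is the permutation obtained by reading the diamonds left to right and, within each diamond, the least element, then the middle elements left to right, then the greatest element. $\mathcal{D}_{v,d}(P)$ is the set of $D$ with $\pi_D$ avoiding every classical pattern in $P$. $des(\pi)$ is the number of $i$ with $\pi_i>\pi_{i+1}$. *)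

(* Defs.v *)
From HB Require Import structures.
From mathcomp Require Import all_boot all_order all_algebra.

Set Implicit Arguments.
Unset Strict Implicit.
Unset Printing Implicit Defensive.

Import Order.TTheory GRing.Theory Num.Theory.

Section Words.
Local Open Scope nat_scope.

Definition des (w : seq nat) : nat :=
  #|[set i : 'I_(size w).-1 | nth 0 w i > nth 0 w i.+1]|.

Definition order_iso (s t : seq nat) : bool :=
  (size s == size t) &&
  [forall i : 'I_(size s), forall j : 'I_(size s),
     (nth 0 s i < nth 0 s j) == (nth 0 t i < nth 0 t j)].

(* A subsequence of w is a mask of w by a tuple of booleans. *)
Definition contains (w p : seq nat) : bool :=
  [exists m : (size w).-tuple bool, order_iso (mask m w) p].

Definition avoids (w p : seq nat) : bool := ~~ contains w p.

End Words.

Section Diamonds.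
Local Open Scope nat_scope.

(* The strict order of the diamond with v vertices: vertex 0 is the least     *)
(* element, vertex v.-1 the greatest one, and 1, ..., v - 2 are the middle    *)
(* elements from left to right.                                               *)
Definition diamond_lt (v : nat) (i j : 'I_v) : bool :=
  ((i == 0 :> nat) && (j != 0 :> nat))
  || ((i != v.-1 :> nat) && (j == v.-1 :> nat)).

(* D (k, i) is the label of vertex i of the k-th diamond; the element l of    *)
(* 'I_(v * d) stands for the label l.+1. An injective labelling uses each     *)
(* label exactly once, as there are as many labels as vertices.               *)
Definition diamond_labelling (v d : nat) := {ffun 'I_d * 'I_v -> 'I_(v * d)}.

Definition diamonds (v d : nat) : {set diamond_labelling v d} :=
  [set D : diamond_labelling v d | injectiveb D &
     [forall k, forall i, forall j,
        diamond_lt i j ==> (D (k, i) < D (k, j))]].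

Definition diamond_word (v d : nat) (D : diamond_labelling v d) : seq nat :=
  [seq (D (k, i)).+1 | k <- enum 'I_d, i <- enum 'I_v].

Definition diamonds_avoiding (v d : nat) (P : seq (seq nat)) :
    {set diamond_labelling v d} :=
  [set D in diamonds v d | all (avoids (diamond_word D)) P].

End Diamonds.

Section PowerSeries.
Local Open Scope ring_scope.
Variable R : comUnitRingType.

(* The formal power series \sum_n (a n) y^n is the function a. *)
Definition fps := nat -> R.

Definition fps_of_poly (p : {poly R}) : fps := fun n => p`_n.

Definition fps_mul (a b : fps) : fps :=
  fun n => \sum_(i < n.+1) a i * b (n - i)%N.

(* The first n.+1 coefficients of the multiplicative inverse of a. *)
Fixpoint fps_inv_seq (a : fps) (n : nat) : seq R :=
  if n is m.+1 then
    let s := fps_inv_seq a m in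
    rcons s (- (a 0%N)^-1 * \sum_(i < n) a i.+1 * s`_(m - i))
  else [:: (a 0%N)^-1].

Definition fps_inv (a : fps) : fps := fun n => (fps_inv_seq a n)`_n.

Definition fps_div (a b : fps) : fps := fps_mul a (fps_inv b).

Lemma size_fps_inv_seq a n : size (fps_inv_seq a n) = n.+1.
Proof. by elim: n => //= n IHn; rewrite size_rcons IHn. Qed.

Lemma nth_fps_inv_seq a n i : (i <= n)%N -> (fps_inv_seq a n)`_i = fps_inv a i.
Proof.
elim: n => [|n IHn]; first by rewrite leqn0 => /eqP->.
rewrite leq_eqVlt => /predU1P[-> //|lt_in].
by rewrite /= nth_rcons size_fps_inv_seq lt_in IHn.
Qed.

Lemma fps_mulV (a : fps) : a 0%N \is a GRing.unit ->
  fps_mul a (fps_inv a) =1 fps_of_poly 1.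
Proof.
move=> Ua [|n]; rewrite /fps_mul /fps_of_poly coef1.
  by rewrite big_ord1 /fps_inv /= divrr.
rewrite big_ord_recl subn0 /= {1}/fps_inv /= nth_rcons size_fps_inv_seq.
rewrite ltnn eqxx mulrA mulrN divrr // mulN1r addrC; apply/eqP; rewrite subr_eq0.
apply/eqP/eq_bigr => i _; rewrite nth_fps_inv_seq ?leq_subr //.
Qed.

End PowerSeries.

Section GeneratingFunction.
Local Open Scope ring_scope.

(* A power series in y whose coefficients are polynomials in x = 'X. *)
Definition diamond_gf (v : nat) (P : seq (seq nat)) : fps {poly int} :=
  fun d => if d == 0%N then 1
           else \sum_(D in diamonds_avoiding v d P) 'X^(des (diamond_word D)).

End GeneratingFunction.

(* Main.v *)
Require Import Defs.
From HB Require Import structures.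
From mathcomp Require Import all_boot all_order all_algebra.
From mathcomp Require Import zify ring.

Import Order.TTheory GRing.Theory Num.Theory.
Local Open Scope ring_scope.

(** A permutation of 1, ..., n avoids 132, 213 and 321 exactly when it is a
    rotation of the identity. Inside a diamond the least label comes first, so
    the cut of the rotation falls between two diamonds: there are d admissible
    words, the identity and d - 1 words with a single descent. Hence the
    coefficient of y^d is 1 + (d - 1) x, which is that of the right-hand side,
    since 1 / (1 - y)^2 is the sum of the (n + 1) y^n. *)

(** * Pattern avoidance and rotations of the identity word *)

Section Words.
Local Open Scope nat_scope.

(** Replaces masks by strictly increasing lists of positions, so that pattern occurrences become
    statements about indices. *)
Lemma subseq_nthP (T : eqType) (x0 : T) (s w : seq T) :
  reflect (exists t, [/\ sorted ltn t, all (gtn (size w)) t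
                       & s = [seq nth x0 w i | i <- t]])
          (subseq s w).
Proof.
apply: (iffP idP) => [/subseqP[m _ ->]|[t [t_sorted /allP lt_t ->]]].
  exists (mask m (iota 0 (size w))); split.
  - exact: sorted_mask ltn_trans _ _ (iota_ltn_sorted 0 _).
  - by apply/allP => i /mem_mask; rewrite mem_iota.
  - by rewrite map_mask -/(mkseq _ _) mkseq_nth.
rewrite -[w in subseq _ w](mkseq_nth x0) map_subseq //.
(* Both lists are strictly sorted with the same members, hence equal. *)
suff -> : t = [seq i <- iota 0 (size w) | i \in t] by apply: filter_subseq.
apply: (irr_sorted_eq ltn_trans ltnn) => //.
  exact: sorted_filter ltn_trans _ _ (iota_ltn_sorted 0 _).
move=> i; rewrite mem_filter mem_iota add0n /=.
by case: (boolP (i \in t)) => // /lt_t /= ->.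
Qed.

Lemma avoidsP (w p : seq nat) :
  reflect (forall t, sorted ltn t -> all (gtn (size w)) t ->
             ~~ order_iso [seq nth 0 w i | i <- t] p)
          (avoids w p).
Proof.
apply: (iffP idP) => [av t t_sorted lt_t|av]; apply/negP.
  move=> iso; case/negP: av; apply/existsP.
  have /subseqP[m sz_m def_m] : subseq [seq nth 0 w i | i <- t] w.
    by apply/(subseq_nthP _ 0); exists t.
  by exists (Tuple (introT eqP sz_m)); rewrite -def_m.
case/existsP => m.
have /(subseq_nthP _ 0)[t [t_sorted lt_t ->]] := mask_subseq m w.
exact/negP/av.
Qed.

(** The diagonal pairs agree trivially; the six comparisons left are in a form that [lia]
    decides. *)
Lemma order_iso3 (x y z a b c : nat) :
  order_iso [:: x; y; z] [:: a; b; c] =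
  [&& (x < y) == (a < b), (x < z) == (a < c), (y < z) == (b < c),
      (y < x) == (b < a), (z < x) == (c < a) & (z < y) == (c < b)].
Proof.
rewrite /order_iso eqxx /=; apply/forallP/idP => [iso|].
  have E i j : i < 3 -> j < 3 ->
      (nth 0 [:: x; y; z] i < nth 0 [:: x; y; z] j)
      == (nth 0 [:: a; b; c] i < nth 0 [:: a; b; c] j).
    by move=> i3 j3; apply: (forallP (iso (Ordinal i3)) (Ordinal j3)).
  by rewrite (E 0 1) // (E 0 2) // (E 1 2) // (E 1 0) // (E 2 0) // (E 2 1).
case/and5P => ? ? ? ? /andP[? ?] i.
by apply/forallP => j; case: i j => [[|[|[|?]]] //= ?] [[|[|[|?]]] //= ?];
  rewrite ?ltnn.
Qed.

Lemma avoids3P (w : seq nat) (a b c : nat) :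
  reflect (forall p q r, p < q < r -> r < size w ->
             ~~ order_iso [:: nth 0 w p; nth 0 w q; nth 0 w r] [:: a; b; c])
          (avoids w [:: a; b; c]).
Proof.
apply: (iffP (avoidsP _ _)) => [av p q r /andP[pq qr] rw|av t].
  by apply: (av [:: p; q; r]) => /=; lia.
case: t => [|p [|q [|r [|? ?]]]] //=; rewrite !andbT => pqr /and3P[_ _ rw].
exact: av.
Qed.

Lemma nth_rot_iota (n c p : nat) : c <= n -> p < n ->
  nth 0 (rot c (iota 1 n)) p = ((c + p) %% n).+1.
Proof.
move=> cn pn; rewrite /rot nth_cat size_drop size_iota nth_drop.
case: ltnP => ?; first by rewrite nth_iota ?modn_small; lia.
rewrite nth_take ?nth_iota; try lia.
have -> : c + p = n + (p - (n - c)) by lia.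
by rewrite modnDl modn_small; lia.
Qed.

(* In a cyclic sense every letter is followed by its successor: otherwise the
   position of the missing successor (or, at a descent, of the predecessor of
   the lower letter) yields one of the three patterns. *)
Lemma avoids_132_213_321P (n : nat) (w : seq nat) : perm_eq w (iota 1 n) ->
  reflect (exists2 c, c < n \/ c = 0 & w = rot c (iota 1 n))
          (all (avoids w) [:: [:: 1; 3; 2]; [:: 2; 1; 3]; [:: 3; 2; 1]]).
Proof.
move=> w_perm; have sz_w : size w = n by rewrite (perm_size w_perm) size_iota.
have w_mem x : (x \in w) = (0 < x <= n).
  by rewrite (perm_mem w_perm) mem_iota; lia.
have w_bd p : p < n -> 0 < nth 0 w p <= n.
  by move=> pn; rewrite -w_mem mem_nth ?sz_w.
have w_uniq : uniq w by rewrite (perm_uniq w_perm) iota_uniq.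
rewrite /= andbT; apply: (iffP and3P) => [[]|[c c_lt ->]].
  move=> /avoids3P av132 /avoids3P av213 /avoids3P av321.
  have succ_w p : p.+1 < n -> nth 0 w p.+1 = (nth 0 w p %% n).+1.
    move=> pn; have w_p := w_bd p (ltnW pn); have w_p1 := w_bd _ pn.
    have ne_p : nth 0 w p != nth 0 w p.+1 by rewrite nth_uniq ?sz_w; lia.
    (* A third letter stands left or right of the adjacent pair, so each case below has two
       subcases. *)
    have pos x : 0 < x <= n -> x != nth 0 w p -> x != nth 0 w p.+1 ->
        exists2 q, x = nth 0 w q & q < p \/ p.+1 < q < n.
      rewrite -w_mem => /(nthP 0)[q]; rewrite sz_w => qn <- n1 n2.
      exists q => //.
      have : q != p by apply: contraNneq n1 => ->.
      by have : q != p.+1 by [apply: contraNneq n2 => ->]; lia.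
    have [asc|dsc] := ltnP (nth 0 w p) (nth 0 w p.+1).
      (* At an ascent from a to b with b > a + 1, the letter a + 1 gives 213 on the left and 132 on
         the right. *)
      rewrite modn_small; last lia.
      apply/eqP; apply/negPn/negP => neq.
      have [|||q def_q [qp|/andP[pq qn]]] := pos (nth 0 w p).+1; try lia.
        have := av213 q p p.+1; rewrite order_iso3 sz_w; lia.
      have := av132 p p.+1 q; rewrite order_iso3 sz_w; lia.
    have [top|] := eqVneq (nth 0 w p) n.
      (* At a descent from [n] to b > 1, the letter b - 1 gives 132 on the left and 321 on the
         right. *)
      rewrite top modnn; apply/eqP; apply/negPn/negP => neq.
      have [|||q def_q [qp|/andP[pq qn]]] := pos (nth 0 w p.+1).-1; try lia.
        have := av132 q p p.+1; rewrite order_iso3 sz_w; lia.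
      have := av321 p p.+1 q; rewrite order_iso3 sz_w; lia.
    (* A descent from a < n is impossible: a + 1 gives 321 on the left and 213 on the right. *)
    move=> neq.
    have [|||q def_q [qp|/andP[pq qn]]] := pos (nth 0 w p).+1; try lia.
      have := av321 q p p.+1; rewrite order_iso3 sz_w; lia.
    have := av213 p p.+1 q; rewrite order_iso3 sz_w; lia.
  (* The rotation by c < n starts with c + 1; for the empty word the default letter 0 gives c =
     0. *)
  exists (nth 0 w 0).-1.
    have [n0|n_gt0] := posnP n; last by have := w_bd 0 n_gt0; left; lia.
    by right; rewrite nth_default // sz_w n0.
  apply: (@eq_from_nth _ 0) => [|p]; first by rewrite size_rot size_iota.
  rewrite sz_w; elim: p => [|p IHp] pn.
    by have w_0 := w_bd 0 pn; rewrite nth_rot_iota ?addn0 ?modn_small; lia.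
  have w_0 := w_bd 0 (leq_ltn_trans (leq0n _) pn).
  rewrite succ_w // IHp ?(ltnW pn) // !nth_rot_iota; try lia.
  by congr _.+1; rewrite -addn1 modnDml; congr (_ %% _); lia.
have cn : c <= n by lia.
(* There are two increasing runs, the upper one first; p < q < r can meet them in four ways, none of
   which forms a forbidden pattern. *)
have val p : p < n -> nth 0 (rot c (iota 1 n)) p =
    if c + p < n then (c + p).+1 else (c + p - n).+1.
  move=> pn; rewrite nth_rot_iota //; case: ltnP => ?.
    by rewrite modn_small.
  have -> : c + p = n + (c + p - n) by lia.
  by rewrite modnDl modn_small; lia.
split; apply/avoids3P => p q r pqr; rewrite size_rot size_iota => rn;
  rewrite order_iso3 !val; try lia;
  case: (ltnP (c + p) n) => ?; case: (ltnP (c + q) n) => ?;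
  case: (ltnP (c + r) n) => ?; lia.
Qed.

(** The only possible descent is from [n] to 1, where the rotation wraps around. *)
Lemma des_rot_iota (n c : nat) : c < n -> des (rot c (iota 1 n)) = (c != 0).
Proof.
move=> cn; rewrite /des; set w := rot c _.
have sz_w : (size w).-1 = n.-1 by rewrite size_rot size_iota.
have descent p : p < n.-1 -> (nth 0 w p.+1 < nth 0 w p) = (p.+1 + c == n).
  move=> pn; rewrite !nth_rot_iota; try lia.
  case: (ltngtP (p.+1 + c) n) => pc.
  - by rewrite !modn_small; lia.
  - have -> : c + p = n + (c + p - n) by lia.
    have -> : c + p.+1 = n + (c + p.+1 - n) by lia.
    by rewrite !modnDl !modn_small; lia.
  - have -> : c + p.+1 = n by lia.
    by rewrite modnn modn_small; lia.
case: c => [|c] in w sz_w cn descent *; rewrite /=.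
  apply/eqP; rewrite cards_eq0; apply/eqP/setP => i; rewrite !inE.
  by have := ltn_ord i; rewrite [X in _ < X]sz_w => ?; rewrite descent //; lia.
(* The rotation is by [c.+1] here, so the descent equation p + 1 + (c + 1) = n gives this
   position. *)
have lt_p : n - c.+2 < (size w).-1 by lia.
rewrite -(cards1 (Ordinal lt_p)); apply: eq_card => i; rewrite !inE -val_eqE /=.
by have := ltn_ord i; rewrite [X in _ < X]sz_w => ? ; rewrite descent //; lia.
Qed.
End Words.

(** * Diamond labellings and their words *)

Section Diamonds.
Local Open Scope nat_scope.

Lemma nth_allpairs (S T U : Type) (x0 : S) (y0 : T) (z0 : U)
    (f : S -> T -> U) (s : seq S) (t : seq T) (i j : nat) :
  i < size s -> j < size t ->
  nth z0 [seq f x y | x <- s, y <- t] (size t * i + j)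
  = f (nth x0 s i) (nth y0 t j).
Proof.
elim: s i => //= x s IHs [|i] lt_i lt_j; rewrite nth_cat size_map.
  by rewrite muln0 lt_j (nth_map y0).
by rewrite ltnNge mulnS -addnA leq_addr /= addKn IHs.
Qed.

Variables v d : nat.
Implicit Type D : diamond_labelling v d.

Lemma size_diamond_word D : size (diamond_word D) = v * d.
Proof. by rewrite size_allpairs !size_enum_ord mulnC. Qed.

Lemma nth_diamond_word D (k : 'I_d) (i : 'I_v) :
  nth 0 (diamond_word D) (v * k + i) = (D (k, i)).+1.
Proof.
have := @nth_allpairs _ _ _ k i 0 (fun k i => (D (k, i)).+1 : nat) (enum 'I_d) (enum 'I_v) k i.
by rewrite !size_enum_ord !nth_ord_enum => ->.
Qed.

Lemma diamond_position (p : nat) : p < v * d ->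
  exists (k : 'I_d) (i : 'I_v), p = v * k + i.
Proof.
move=> p_lt; have v_gt0 : 0 < v by case: (v) p_lt.
have k_lt : p %/ v < d by rewrite ltn_divLR // mulnC.
have i_lt : p %% v < v by rewrite ltn_mod.
by exists (Ordinal k_lt), (Ordinal i_lt); rewrite /= mulnC -divn_eq.
Qed.

Lemma diamond_word_inj : injective (@diamond_word v d).
Proof.
move=> D1 D2 eqD; apply/ffunP => -[k i]; apply/val_inj/succn_inj.
by rewrite -!nth_diamond_word eqD.
Qed.

Lemma perm_diamond_word D : D \in diamonds v d ->
  perm_eq (diamond_word D) (iota 1 (v * d)).
Proof.
rewrite inE => /andP[/injectiveP D_inj _].
have w_uniq : uniq (diamond_word D).
  apply: allpairs_uniq; rewrite ?enum_uniq // => -[k i] [l j] _ _ /=.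
  by move=> /succn_inj/val_inj/D_inj.
have sub : {subset diamond_word D <= iota 1 (v * d)}.
  by move=> _ /allpairsP[[k i] [_ _ ->]]; rewrite mem_iota; case: (D _) => /= *; lia.
apply: uniq_perm => //; first exact: iota_uniq.
by apply: (uniq_min_size w_uniq sub _).2; rewrite size_diamond_word size_iota.
Qed.

Lemma shift_label_subproof (j k : 'I_d) (i : 'I_v) :
  v * ((j + k) %% d) + i < v * d.
Proof.
have : (j + k) %% d < d by rewrite ltn_mod; case: (d) j => [[]|].
by have := ltn_ord i; nia.
Qed.

(** The candidate avoiders: blocks of [v] consecutive labels move cyclically as wholes, which keeps
    the order inside each diamond. *)
Definition shift_labelling (j : 'I_d) : diamond_labelling v d :=
  [ffun ki => Ordinal (shift_label_subproof j ki.1 ki.2)].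

Lemma diamond_word_shift (j : 'I_d) :
  diamond_word (shift_labelling j) = rot (v * j) (iota 1 (v * d)).
Proof.
apply: (@eq_from_nth _ 0) => [|p].
  by rewrite size_diamond_word size_rot size_iota.
rewrite size_diamond_word => p_lt.
have [k [i ->]] := diamond_position p p_lt.
rewrite nth_diamond_word ffunE /= nth_rot_iota; first last.
- by have := ltn_ord i; have := ltn_ord k; nia.
- by rewrite leq_mul2l (ltnW (ltn_ord j)) orbT.
(* The factor [v] comes out of the remainder, and adding [i < v] causes no further wrap. *)
rewrite addnA -mulnDr -(modnDml (v * (j + k))) -muln_modr [X in _ = X.+1]modn_small //.
exact: shift_label_subproof.
Qed.

Lemma shift_labelling_diamonds (j : 'I_d) : shift_labelling j \in diamonds v d.
Proof.
rewrite inE; apply/andP; split.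
  have d_gt0 : 0 < d by case: (d) j => [[]|].
  apply/injectiveP => -[k1 i1] [k2 i2] /(congr1 val); rewrite !ffunE /= => eq_l.
  have [i1v i2v] := (ltn_ord i1, ltn_ord i2).
  have v_gt0 : 0 < v by apply: leq_ltn_trans i1v.
  (* The remainder and the quotient of a label by [v] recover the vertex and the diamond. *)
  have eq_i : i1 = i2.
    apply: val_inj; move/(congr1 (modn^~ v)): eq_l.
    by rewrite ![v * _]mulnC !modnMDl !modn_small.
  have eq_k : k1 = k2.
    apply: val_inj; move/(congr1 (divn^~ v)): eq_l.
    rewrite ![v * _]mulnC !divnMDl // !divn_small // !addn0 => /eqP.
    by rewrite eqn_modDl !modn_small // => /eqP.
  by rewrite eq_i eq_k.
apply/forallP => k; apply/forallP => i1; apply/forallP => i2; apply/implyP.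
rewrite !ffunE /= ltn_add2l /diamond_lt.
have := ltn_ord i1; have := ltn_ord i2; lia.
Qed.

(* The label 1 stands at position v * d - c of the word, which is therefore
   the least vertex of a diamond, so that v divides c. *)
Lemma diamonds_avoiding_132_213_321 : 0 < d ->
  diamonds_avoiding v d [:: [:: 1; 3; 2]; [:: 2; 1; 3]; [:: 3; 2; 1]]
  = [set shift_labelling j | j : 'I_d].
Proof.
move=> d_gt0.
apply/setP => D; rewrite inE; apply/andP/imsetP => [[D_in]|[j _ ->]]; last first.
  split; first exact: shift_labelling_diamonds.
  apply/(avoids_132_213_321P _ _ (perm_diamond_word _ (shift_labelling_diamonds j))).
  rewrite diamond_word_shift; exists (v * j) => //.
  by have := ltn_ord j; nia.
case/(avoids_132_213_321P _ _ (perm_diamond_word _ D_in)) => c c_lt w_rot.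
suff [j c_j] : exists j : 'I_d, c = v * j.
  by exists j => //; apply: diamond_word_inj; rewrite diamond_word_shift -c_j.
(* For [c = 0] the position [v * d - c] would lie past the end of the word. *)
have [->|c_neq0] := eqVneq c 0; first by exists (Ordinal d_gt0); rewrite muln0.
have [k [i def_k]] : exists (k : 'I_d) (i : 'I_v), v * d - c = v * k + i.
  by apply: diamond_position; lia.
have D_ki : D (k, i) = 0 :> nat.
  apply: succn_inj; rewrite -nth_diamond_word w_rot -def_k nth_rot_iota; try lia.
  by rewrite subnKC ?modnn //; lia.
have v_gt0 : 0 < v by apply: leq_ltn_trans (ltn_ord i).
have i_0 : i = 0 :> nat.
  apply/eqP; apply/negPn/negP => i_neq0; move: D_in; rewrite inE => /andP[_].
  move=> /forallP/(_ k)/forallP/(_ (Ordinal v_gt0))/forallP/(_ i).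
  by rewrite /diamond_lt /= i_neq0 D_ki.
(* Now v * d - c = v * k, so c = v * (d - k), and k > 0 because c < v * d. *)
have j_lt : d - k < d by nia.
by exists (Ordinal j_lt); rewrite /= mulnBr; lia.
Qed.

End Diamonds.

Lemma diamond_gf_132_213_321 (v d : nat) : (0 < v)%N ->
  diamond_gf v [:: [:: 1; 3; 2]; [:: 2; 1; 3]; [:: 3; 2; 1]]%N d.+1
  = 1 + 'X *+ d.
Proof.
move=> v_gt0; rewrite /diamond_gf /= diamonds_avoiding_132_213_321 //.
have lt_n (j : 'I_d.+1) : (v * j < v * d.+1)%N by rewrite ltn_mul2l v_gt0 /=.
rewrite big_imset => [|j1 j2 _ _ /(congr1 (@diamond_word v d.+1))] /=; last first.
  (* The first letter v * j + 1 of the word determines [j]. *)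
  rewrite !diamond_word_shift => /(congr1 (nth 0%N ^~ 0%N)).
  rewrite !nth_rot_iota ?muln_gt0 ?v_gt0 ?(ltnW (lt_n _)) // !addn0 !modn_small //.
  by move/succn_inj/eqP; rewrite eqn_pmul2l // => /eqP/val_inj.
rewrite (eq_bigr (fun j : 'I_d.+1 => 'X^(j != 0%N :> nat))) => [|j _]; last first.
  by rewrite diamond_word_shift des_rot_iota // muln_eq0 -leqn0 leqNgt v_gt0.
rewrite big_ord_recl expr0; congr (_ + _).
by rewrite sumr_const card_ord.
Qed.

(** * Coefficients of the quotient of power series *)

Section PowerSeries.
Variable R : comUnitRingType.

Lemma fps_mul_poly3 (p : {poly R}) (b : fps R) (n : nat) : (size p <= 3)%N ->
  fps_mul (fps_of_poly p) b n.+2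
  = p`_0 * b n.+2 + p`_1 * b n.+1 + p`_2 * b n.
Proof.
move=> sz_p; rewrite /fps_mul /fps_of_poly !big_ord_recl big1 => [|i _].
  by rewrite /= addr0 addrA !subSS !subn0.
by rewrite nth_default ?mul0r // (leq_trans sz_p).
Qed.

Lemma fps_mul_poly1 (p : {poly R}) (b : fps R) :
  fps_mul (fps_of_poly p) b 1 = p`_0 * b 1%N + p`_1 * b 0%N.
Proof. by rewrite /fps_mul !big_ord_recl big_ord0 addr0. Qed.

Lemma fps_mul_poly0 (p : {poly R}) (b : fps R) :
  fps_mul (fps_of_poly p) b 0 = p`_0 * b 0%N.
Proof. by rewrite /fps_mul big_ord1. Qed.

(** Multiplying back gives the recurrence f(n+2) = 2 f(n+1) - f(n) with f(0) = 1 and f(1) = 2. *)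
Lemma fps_inv_sqr_1subX (n : nat) :
  fps_inv (fps_of_poly ((1 - 'X) ^+ 2 : {poly R})) n = n.+1%:R.
Proof.
set b := (1 - 'X) ^+ 2.
have def_b : b = Poly [:: 1; - 2; 1].
  by rewrite /b /= !cons_poly_def mul0r add0r polyCN -[(2 : R)%:P]/(1 + 1)%:P polyCD; ring.
have Ub : fps_of_poly b 0 \is a GRing.unit.
  by rewrite /fps_of_poly def_b coef_Poly unitr1.
have b_inv := fps_mulV Ub.
have c0 : b`_0 = 1 by rewrite def_b coef_Poly.
have c1 : b`_1 = - 2 by rewrite def_b coef_Poly.
have c2 : b`_2 = 1 by rewrite def_b coef_Poly.
have sz_b : (size b <= 3)%N by rewrite def_b size_Poly.
set f := fps_inv _ in b_inv *.
have f0 : f 0%N = 1.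
  by have := b_inv 0%N; rewrite fps_mul_poly0 c0 mul1r /fps_of_poly coef1.
have f1 : f 1%N = 2.
  have := b_inv 1%N; rewrite fps_mul_poly1 c0 c1 f0 /fps_of_poly coef1 /= => E.
  have -> : f 1%N = 1 * f 1%N + - 2 * 1 + 2 by ring.
  by rewrite E add0r.
(* The recurrence has order two, so the induction carries two consecutive coefficients. *)
suff [] : f n = n.+1%:R /\ f n.+1 = n.+2%:R by [].
elim: n => [|n [IH1 IH2]]; first by rewrite f0 f1.
split=> //; have := b_inv n.+2.
rewrite fps_mul_poly3 // c0 c1 c2 IH1 IH2 /fps_of_poly coef1 /= => E.
(* The first three terms form the coefficient of the product, which [E] says is 0. *)
have -> : f n.+2 = 1 * f n.+2 + - 2 * n.+2%:R + 1 * n.+1%:R + n.+3%:R.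
  by rewrite -![_.+1%:R]natr1; ring.
by rewrite E add0r.
Qed.

End PowerSeries.

Theorem theorem4p1 (v : nat) (hv : (4 <= v)%N) :
  let x : {poly {poly int}} := ('X)%:P in
  let y : {poly {poly int}} := 'X in
  diamond_gf v [:: [:: 1; 3; 2]; [:: 2; 1; 3]; [:: 3; 2; 1]]%N
  =1 fps_div (fps_of_poly (1 - y + x * y ^+ 2))
             (fps_of_poly ((1 - y) ^+ 2)).
Proof.
move=> x y d; rewrite /fps_div; set f := fps_inv _; set a := 1 - y + _.
have f_n n : f n = n.+1%:R by apply: fps_inv_sqr_1subX.
have def_a : a = Poly [:: 1; - 1; 'X].
  by rewrite /a /= !cons_poly_def mul0r add0r polyCN /x /y; ring.
have v_gt0 : (0 < v)%N by apply: leq_trans hv.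
(* The numerator has degree two in y; from d + 2 on the coefficient is (d + 3) - (d + 2) + (d + 1)
   x. *)
case: d => [|[|d]]; rewrite ?diamond_gf_132_213_321 //.
- by rewrite fps_mul_poly0 def_a coef_Poly f_n mul1r.
- by rewrite fps_mul_poly1 def_a !coef_Poly !f_n /=; ring.
rewrite fps_mul_poly3 def_a ?size_Poly // !coef_Poly !f_n /=; ring.
Qed.
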